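(* For every $n\ge 1$, $\mathfrak{S}^{\mathrm{BPD}}=\sum_{w\in S_n}\mathfrak{S}_w\, w$ in $\mathbb{Q}[x_1,\dots,x_{n-1}][S_n]$.
   Context: Permutations in one-line notation, $w_0=[n,\dots,1]$, $t_{i,j}$ the transposition of $i<j$, $wt_{i,j}$ is $w$ with positions $i,j$ swapped, $\ell$ the number of inversions, and $u\lessdot w$ means $w=ut_{i,j}$ with $\ell(w)=\ell(u)+1$. Schubert polynomials: $\mathfrak{S}_{w_0}=x_1^{n-1}x_2^{n-2}\cdots x_{n-1}$, and for $i\in[n-1]$ with $w(i)>w(i+1)$, $\mathfrak{S}_{wt_{i,i+1}}=\partial_i\mathfrak{S}_w$, where $\partial_i f=\frac{f-f(\dots,x_{i+1},x_i,\dots)}{x_i-x_{i+1}}$. The Fomin–Kirillov algebra $\mathcal{E}_n$ is generated by $d_{i,j}$ ($1\le i<j\le n$) with relations $d_{i,j}^2=0$; $d_{i,j}d_{j,k}=d_{i,k}d_{i,j}+d_{j,k}d_{i,k}$ and $d_{j,k}d_{i,j}=d_{i,j}d_{i,k}+d_{i,k}d_{j,k}$ for $i<j<k$; $d_{i,j}d_{k,l}=d_{k,l}d_{i,j}$ for $i,j,k,l$ distinct. It acts on the right on $\mathbb{Q}[S_n]$ by $w\odot d_{i,j}=wt_{i,j}$ if $wt_{i,j}\lessdot w$ and $0$ otherwise (so $w\odot(e_1e_2)=(w\odot e_1)\odot e_2$). The algebra $\mathbb{Q}[x_1,\dots,x_{n-1}]\otimes\mathcal{E}_n$ acts on the right on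 $\mathbb{Q}[x_1,\dots,x_{n-1}][S_n]$ by $(fw)\odot(g\otimes e)=fg\,(w\odot e)$. For $i<j$ let $B_{i,j}=d_{1,j}+d_{2,j}+\dots+d_{i,j}$, and for $i\in[n-1]$ let $R_i(x_i)=(x_i+B_{i,i+1})(x_i+B_{i,i+2})\cdots(x_i+B_{i,n})$. Define $\mathfrak{S}^{\mathrm{BPD}}=w_0\odot\big(R_1(x_1)R_2(x_2)\cdots R_{n-1}(x_{n-1})\big)$. *)

(* Defs.v *)
From HB Require Import structures.
From mathcomp Require Import all_boot all_order all_algebra all_fingroup.
From mathcomp Require Import mpoly.
From Stdlib Require Import ClassicalEpsilon.
Set Implicit Arguments. Unset Strict Implicit. Unset Printing Implicit Defensive.
Import GRing.Theory.
Local Open Scope ring_scope.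

(* Permutations of positions 'I_n (0-based: paper's position p is p-1 here).
   One-line notation: w(p) = w p. *)

(* polynomial ring Q[x_1,...,x_n]; paper's x_p is 'X_(p-1). *)
Notation Poly n := {mpoly rat[n]}.
Notation GAlg n := {ffun 'S_n -> Poly n}.

Definition ell n (w : 'S_n) : nat :=
  #|[set p : 'I_n * 'I_n | (p.1 < p.2)%N && (w p.2 < w p.1)%N]|.

(* w t_{i,j} : w with positions i and j swapped; (tperm i j * w) x = w (tperm i j x) *)
Definition wt n (w : 'S_n) (i j : 'I_n) : 'S_n := (tperm i j * w)%g.

Definition w0 n : 'S_n := perm (@rev_ord_inj n).

Definition basis n (w : 'S_n) : GAlg n := [ffun u => if u == w then 1 else 0].

(* right action of d_{i,j}, extended linearly:
   w . d_{i,j} = w t_{i,j} if w t_{i,j} <. w, else 0. The coefficient of u in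
   F . d_{i,j} is the coefficient of w = u t_{i,j} in F when u <. u t_{i,j}. *)
Definition dact n (i j : 'I_n) (F : GAlg n) : GAlg n :=
  [ffun u => if ell (wt u i j) == (ell u).+1 then F (wt u i j) else 0].

(* right action of the factor  x_i + B_{i,k},  B_{i,k} = d_{1,k}+...+d_{i,k}
   (0-based: m ranges over 0..i) *)
Definition factor_act n (i k : 'I_n) (F : GAlg n) : GAlg n :=
  [ffun u => 'X_i * F u + \sum_(m : 'I_n | (m <= i)%N) dact m k F u].

(* the factors of R_1(x_1) R_2(x_2) ... R_{n-1}(x_{n-1}) in left-to-right order:
   R_i = (x_i + B_{i,i+1}) ... (x_i + B_{i,n}) *)
Definition factors n : seq ('I_n * 'I_n) :=
  [seq (i, k) | i : 'I_n <- enum 'I_n, k : 'I_n <- [seq k : 'I_n <- enum 'I_n | (i < k)%N]].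

(* S^BPD = w_0 . (R_1 ... R_{n-1}) ; right action, so leftmost factor first *)
Definition SBPD n : GAlg n :=
  foldl (fun F p => factor_act p.1 p.2 F) (basis (w0 n)) (factors n).

(* divided difference d_i f = (f - s_i f)/(x_i - x_j), j = i+1; the quotient
   exists (and is unique) in the polynomial ring *)
Definition ddiff n (i j : 'I_n) (f : Poly n) : Poly n :=
  epsilon (inhabits 0)
    (fun g : Poly n => ('X_i - 'X_j) * g = f - msym (tperm i j) f).

Definition schub_top n : Poly n := \prod_(i < n) 'X_i ^+ (n.-1 - i).

(* S_w via the recursion S_{w t_{i,i+1}} = d_i S_w (w(i) > w(i+1)):
   if w <> w_0, pick an ascent i (w(i) < w(i+1)); then w' = w t_{i,i+1} has a
   descent at i and S_w = d_i S_{w'}.  Fuel bounds the length increase. *)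
Fixpoint schub_fuel n (fuel : nat) (w : 'S_n) : Poly n :=
  match fuel with
  | 0 => schub_top n
  | f.+1 =>
    if w == w0 n then schub_top n else
    match [pick p : 'I_n * 'I_n | (val p.2 == (val p.1).+1) && (w p.1 < w p.2)%N] with
    | Some p => ddiff p.1 p.2 (schub_fuel f (wt w p.1 p.2))
    | None => schub_top n
    end
  end.

Definition schubert n (w : 'S_n) : Poly n := schub_fuel (n * n) w.

(* Main.v *)
Require Import Defs.
From HB Require Import structures.
From mathcomp Require Import all_boot all_order all_algebra all_fingroup.
From mathcomp Require Import mpoly.
From mathcomp Require Import zify ring.
From Stdlib Require Import ClassicalEpsilon.
Set Implicit Arguments. Unset Strict Implicit. Unset Printing Implicit Defensive.
Import GRing.Theory.
Local Open Scope ring_scope.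

(** Let [theta_k = sum_m d_{k,m}], with [d_{m,k} = - d_{k,m}], be the Dunkl
elements; the Fomin-Kirillov relations make them commute. On permutations
decreasing from position [i] on, the row [R_i(x)] acts as
[prod_(k > i) (x - theta_k)], so that [S^BPD = w_0 . prod_(i < k) (x_i - theta_k)],
a product of commuting factors. Let [U_i] send [w] to [w t_{i,i+1}] if this is
longer and to [0] otherwise. Then [U_i] and the [theta_k] satisfy the nil-Hecke
relations, [theta_{i+1} U_i = U_i theta_i - 1] in particular. Exchanging [x_i] and
[x_{i+1}] only changes the factor [x_i - theta_{i+1}], and [U_i] annihilates [w_0]
times the other factors; this yields the divided difference recursion. *)

(** * Bruhat covers *)

(** The pointwise criterion for a Bruhat cover: no point of the graph of [u] lies strictly inside
    the rectangle spanned by positions [i] and [j]. It agrees with the length condition by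
    [ell_covers]. *)
Definition covers n (u : 'S_n) (i j : 'I_n) : bool :=
  (u i < u j)%N && [forall p : 'I_n, ~~ ((i < p < j) && (u i < u p < u j))%N].

(** Isolates the pairs that meet [i] or [j], the only ones whose inversion status a swap of these
    positions can change. *)
Lemma sum_split_two (n : nat) (i j : 'I_n) (f : 'I_n -> 'I_n -> nat) : i != j ->
  (\sum_p \sum_q f p q =
   (f i i + f j j + f i j + f j i) +
   (\sum_(r | (r != i) && (r != j)) (f i r + f r i + f j r + f r j) +
    \sum_(p | (p != i) && (p != j)) \sum_(q | (q != i) && (q != j)) f p q))%N.
Proof.
move=> nij.
have E g : (\sum_q g q = g i + g j + \sum_(q | (q != i) && (q != j)) g q)%N.
  by rewrite (bigD1 i) //= (bigD1 j) /= ?addnA // eq_sym.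
have EE : (\sum_(p | (p != i) && (p != j)) \sum_q f p q =
  \sum_(p | (p != i) && (p != j)) f p i + \sum_(p | (p != i) && (p != j)) f p j +
  \sum_(p | (p != i) && (p != j)) \sum_(q | (q != i) && (q != j)) f p q)%N.
  by rewrite -!big_split /=; apply: eq_bigr => r _; rewrite E.
rewrite E !E EE !big_split /=; lia.
Qed.

Lemma ell_sum n (w : 'S_n) :
  ell w = (\sum_(p : 'I_n) \sum_(q : 'I_n) ((p < q)%N && (w q < w p)%N : nat))%N.
Proof.
rewrite /ell cardsE -sum1_card big_mkcond /= pair_big /=.
by apply: eq_bigr => -[p q] _; rewrite unfold_in /=; case: (_ && _).
Qed.

Lemma perm_val_neq n (u : 'S_n) (i j : 'I_n) : i != j -> (u i != u j :> nat).
Proof. by apply: contraNneq => /val_inj/perm_inj ->. Qed.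

Lemma wtE n (u : 'S_n) i j p : wt u i j p = u (tperm i j p).
Proof. by rewrite /wt permM. Qed.

(** The pair [i, j] becomes an inversion. For any other [r], the inversions of [r] with [i] and [j]
    together grow by two if [r] lies between them in position and in value, and keep their number
    otherwise. *)
Lemma ell_wt n (u : 'S_n) (i j : 'I_n) : (i < j)%N -> (u i < u j)%N ->
  ell (wt u i j) = (ell u + 1 +
    2 * \sum_(r : 'I_n | (r != i) && (r != j)) ((i < r < j) && (u i < u r < u j) : nat))%N.
Proof.
move=> ij uij.
have nij : i != j by rewrite neq_ltn ij.
rewrite !ell_sum !(sum_split_two _ nij) !wtE tpermL tpermR.
rewrite (eq_bigr (fun r : 'I_n => (((i < r) && (u r < u i)) + ((r < i) && (u i < u r)) +
   ((j < r) && (u r < u j)) + ((r < j) && (u j < u r))) +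
   2 * ((i < r < j) && (u i < u r < u j)))%N); last first.
  move=> r /andP[ri rj]; rewrite !wtE tpermD 1?eq_sym //.
  have := perm_val_neq u ri; have := perm_val_neq u rj.
  move: ri rj; rewrite -!(inj_eq val_inj) /=; lia.
rewrite [in LHS]big_split /= -big_distrr /=.
set S1 := (\sum_(i0 | _) (_ + _))%N; set S2 := (\sum_(i0 | _) _)%N.
set S3 := (\sum_(p | _) _)%N; set S4 := (\sum_(p | _) _)%N.
have -> : S3 = S4.
  apply: eq_bigr => p /andP[pi pj]; apply: eq_bigr => q /andP[qi qj].
  by rewrite !wtE !tpermD // eq_sym.
lia.
Qed.

Lemma wt_sym n (u : 'S_n) i j : wt u i j = wt u j i.
Proof. by rewrite /wt tpermC. Qed.

Lemma wtK n (u : 'S_n) i j : wt (wt u i j) i j = u.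
Proof. by rewrite /wt mulgA tperm2 mul1g. Qed.

Lemma ell_covers n (u : 'S_n) (i j : 'I_n) : (i < j)%N ->
  (ell (wt u i j) == (ell u).+1) = covers u i j.
Proof.
move=> ij; rewrite /covers.
have nij : i != j by rewrite neq_ltn ij.
case: (ltnP (u i) (u j)) => [uij|uji] /=.
  rewrite ell_wt //; set S := (\sum_(r | _) _)%N.
  transitivity (S == 0%N); first by lia.
  rewrite /S sum_nat_eq0; apply: eq_forallb => r.
  case: eqP => [->|_] /=; first by rewrite ltnn.
  case: eqP => [->|_] /=; first by rewrite ltnn andbF.
  by case: (_ && _).
have uji' : (u j < u i)%N by have := perm_val_neq u nij; lia.
apply/negbTE/eqP.
(* At a descent the formula applies to the swapped permutation, so the swap lowers the length. *)
have := @ell_wt n (wt u i j) i j ij.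
rewrite wtK !wtE tpermL tpermR => /(_ uji'); lia.
Qed.

Lemma dactC n (i j : 'I_n) F : dact i j F = dact j i F.
Proof. by apply/ffunP => u; rewrite !ffunE wt_sym. Qed.

Lemma dactE n (i j : 'I_n) F u : (i < j)%N ->
  dact i j F u = if covers u i j then F (wt u i j) else 0.
Proof. by move=> ij; rewrite ffunE ell_covers. Qed.

Lemma dact_is_additive n (i j : 'I_n) : zmod_morphism (@dact n i j).
Proof.
by move=> F G; apply/ffunP => u; rewrite !ffunE; case: ifP; rewrite ?subr0.
Qed.
HB.instance Definition _ n (i j : 'I_n) :=
  GRing.isZmodMorphism.Build (GAlg n) (GAlg n) (@dact n i j) (@dact_is_additive n i j).

(** * Fomin-Kirillov relations *)

Lemma coversP n (u : 'S_n) (i j : 'I_n) :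
  reflect ((u i < u j)%N /\ forall p : 'I_n, ~~ ((i < p < j) && (u i < u p < u j))%N)
    (covers u i j).
Proof. by apply: (iffP andP) => -[? /forallP]. Qed.

Lemma wt_if n (u : 'S_n) i j p :
  wt u i j p = if p == i then u j else if p == j then u i else u p.
Proof.
rewrite wtE; case: tpermP => [->|->|/eqP/negPf-> /eqP/negPf->] //; rewrite ?eqxx //.
by case: eqP => [->|].
Qed.

Lemma neq_facts n (u : 'S_n) (i j : 'I_n) : i != j ->
  [/\ (i == j) = false, (j == i) = false, (i != j :> nat)%N & (u i != u j :> nat)%N].
Proof. by move=> h; split; rewrite ?(perm_val_neq u h) // ?(negPf h) // eq_sym (negPf h). Qed.

Ltac simp_if := repeat (first [rewrite eqxx |
  match goal with H : (?a == ?b) = false |- context[?a == ?b] => rewrite H end]);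
  cbv iota.
Ltac facts u h := have [? ? ? ?] := neq_facts u h.
Ltac split_at u p i :=
  case: (eqVneq p i) => [->|/(neq_facts u)[? ? ? ?]].

(* [lia] does not terminate in reasonable time in the presence of these hypotheses. *)
Ltac purge := repeat match goal with
  | H : (_ == _) = false |- _ => clear H
  | H : is_true (@negb (@eq_op (fintype_ordinal__canonical__eqtype_Equality _) _ _)) |- _ =>
    clear H end.

Section Three.
Variables (n : nat) (u : 'S_n) (i j k : 'I_n).
Hypotheses (ij : (i < j)%N) (jk : (j < k)%N).

Let nij : i != j. Proof. by rewrite neq_ltn ij. Qed.
Let njk : j != k. Proof. by rewrite neq_ltn jk. Qed.
Let nik : i != k. Proof. by rewrite neq_ltn (ltn_trans ij jk). Qed.

Ltac prep := facts u nij; facts u njk; facts u nik.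
Ltac solve3 H1 H2 := apply/coversP; split;
  [ move: (H1 i) (H1 j) (H1 k) (H2 i) (H2 j) (H2 k); clear H1 H2
  | let p := fresh "p" in move=> p;
    split_at u p i; last (split_at u p j; last (split_at u p k));
    [ move: (H1 i) (H1 j) (H1 k) (H2 i) (H2 j) (H2 k) ..
    | move: (H1 p) (H2 p) ]; clear H1 H2 ];
  rewrite ?wt_if; simp_if; purge; lia.

(** The coefficient at [u] of the first three-term relation. The order of [u i] and [u j] decides
    which product on the right survives, hence also the exclusion lemma that follows. *)
Lemma covers_three1 :
  covers u j k && covers (wt u j k) i j =
  (covers u i j && covers (wt u i j) i k) || (covers u i k && covers (wt u i k) j k).
Proof.
prep; apply/idP/idP; last case/orP; move=> /andP[/coversP[h1 H1] /coversP[h2 H2]];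
  move: h2; rewrite ?wt_if; simp_if => h2.
- case: (ltnP (u i) (u j)) => h; apply/orP; [left|right]; apply/andP; split; solve3 H1 H2.
- apply/andP; split; solve3 H1 H2.
- apply/andP; split; solve3 H1 H2.
Qed.

Lemma covers_three1_excl :
  ~~ ((covers u i j && covers (wt u i j) i k) && (covers u i k && covers (wt u i k) j k)).
Proof.
prep; apply/negP => /andP[/andP[/coversP[h1 H1] _] /andP[_ /coversP[h2 H2]]].
by move: h2; rewrite ?wt_if; simp_if; lia.
Qed.

(** The analogue for the second three-term relation; here the order of [u j] and [u k] decides. *)
Lemma covers_three2 :
  covers u i j && covers (wt u i j) j k =
  (covers u i k && covers (wt u i k) i j) || (covers u j k && covers (wt u j k) i k).
Proof.
prep; apply/idP/idP; last case/orP; move=> /andP[/coversP[h1 H1] /coversP[h2 H2]];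
  move: h2; rewrite ?wt_if; simp_if => h2.
- case: (ltnP (u j) (u k)) => h; apply/orP; [right|left]; apply/andP; split; solve3 H1 H2.
- apply/andP; split; solve3 H1 H2.
- apply/andP; split; solve3 H1 H2.
Qed.

Lemma covers_three2_excl :
  ~~ ((covers u i k && covers (wt u i k) i j) && (covers u j k && covers (wt u j k) i k)).
Proof.
prep; apply/negP => /andP[/andP[_ /coversP[h1 H1]] /andP[/coversP[h2 H2] _]].
by move: h1; rewrite ?wt_if; simp_if; lia.
Qed.
End Three.

Lemma dact2E n (i j k l : 'I_n) F u : (i < j)%N -> (k < l)%N ->
  dact k l (dact i j F) u =
  if covers u k l && covers (wt u k l) i j then F (wt (wt u k l) i j) else 0.
Proof. by move=> ij kl; rewrite !dactE //; case: (covers u k l). Qed.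

Ltac perm_eq3 u i j k := let p := fresh "p" in apply/permP => p;
  split_at u p i; last (split_at u p j; last split_at u p k);
  rewrite ?wt_if; simp_if; reflexivity.

Section FK.
Variables (n : nat) (i j k : 'I_n).
Hypotheses (ij : (i < j)%N) (jk : (j < k)%N).

Let nij : i != j. Proof. by rewrite neq_ltn ij. Qed.
Let njk : j != k. Proof. by rewrite neq_ltn jk. Qed.
Let nik : i != k. Proof. by rewrite neq_ltn (ltn_trans ij jk). Qed.

(** For a right action the innermost [dact] is the leftmost generator, so this reads [d_{i,j}
    d_{j,k} = d_{i,k} d_{i,j} + d_{j,k} d_{i,k}]. All three products lead to the same
    permutation. *)
Lemma dact_three1 F :
  dact j k (dact i j F) = dact i j (dact i k F) + dact i k (dact j k F).
Proof.
have ik := ltn_trans ij jk.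
apply/ffunP => u; rewrite [in RHS]ffunE !dact2E // covers_three1 //.
have := covers_three1_excl u ij jk.
facts u nij; facts u njk; facts u nik.
have -> : wt (wt u i j) i k = wt (wt u j k) i j by perm_eq3 u i j k.
have -> : wt (wt u i k) j k = wt (wt u j k) i j by perm_eq3 u i j k.
by case: (covers u i j && _); case: (covers u i k && _) => //=; rewrite ?addr0 ?add0r.
Qed.

Lemma dact_three2 F :
  dact i j (dact j k F) = dact i k (dact i j F) + dact j k (dact i k F).
Proof.
have ik := ltn_trans ij jk.
apply/ffunP => u; rewrite [in RHS]ffunE !dact2E // covers_three2 //.
have := covers_three2_excl u ij jk.
facts u nij; facts u njk; facts u nik.
have -> : wt (wt u i k) i j = wt (wt u i j) j k by perm_eq3 u i j k.
have -> : wt (wt u j k) i k = wt (wt u i j) j k by perm_eq3 u i j k.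
by case: (covers u i k && _); case: (covers u j k && _) => //=; rewrite ?addr0 ?add0r.
Qed.
End FK.

Ltac solve4 i j k l H1 H2 u := apply/coversP; split;
  [ move: (H1 i) (H1 j) (H1 k) (H1 l) (H2 i) (H2 j) (H2 k) (H2 l); clear H1 H2
  | let p := fresh "p" in move=> p;
    split_at u p i; last (split_at u p j; last (split_at u p k; last (split_at u p l)));
    [ move: (H1 i) (H1 j) (H1 k) (H1 l) (H2 i) (H2 j) (H2 k) (H2 l)..
    | move: (H1 p) (H2 p) ]; clear H1 H2 ];
  rewrite ?wt_if; simp_if; purge; lia.

Lemma covers_disjoint n (u : 'S_n) (i j k l : 'I_n) : (i < j)%N -> (k < l)%N ->
  i != k -> i != l -> j != k -> j != l ->
  covers u i j && covers (wt u i j) k l -> covers u k l && covers (wt u k l) i j.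
Proof.
move=> ij kl nik nil njk njl.
have nij : i != j by rewrite neq_ltn ij.
have nkl : k != l by rewrite neq_ltn kl.
facts u nij; facts u nkl; facts u nik; facts u nil; facts u njk; facts u njl.
move=> /andP[/coversP[h1 H1] /coversP[h2 H2]].
move: h2; rewrite ?wt_if; simp_if => h2.
apply/andP; split; solve4 i j k l H1 H2 u.
Qed.

Lemma dact_id n (i : 'I_n) F : dact i i F = 0.
Proof. by apply/ffunP=> u; rewrite !ffunE /wt tperm1 mul1g eqn_leq ltnn andbF. Qed.

Lemma dact_disjoint n (i j k l : 'I_n) F :
  i != k -> i != l -> j != k -> j != l ->
  dact i j (dact k l F) = dact k l (dact i j F).
Proof.
wlog ij : i j / (i < j)%N.
  move=> W nik nil njk njl; case: (ltngtP i j) => ij; first exact: W.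
    by rewrite (dactC i j) W // (dactC i j).
  by rewrite (val_inj ij) !dact_id raddf0.
wlog kl : k l / (k < l)%N.
  move=> W nik nil njk njl; case: (ltngtP k l) => kl; first exact: W.
    by rewrite (dactC k l) W // (dactC k l).
  by rewrite (val_inj kl) !dact_id raddf0.
move=> nik nil njk njl.
have nij : i != j by rewrite neq_ltn ij.
have nkl : k != l by rewrite neq_ltn kl.
apply/ffunP => u; rewrite !dact2E //.
facts u nij; facts u nkl; facts u nik; facts u nil; facts u njk; facts u njl.
have -> : wt (wt u k l) i j = wt (wt u i j) k l.
  apply/permP => p.
  split_at u p i; last (split_at u p j; last (split_at u p k; last split_at u p l));
  rewrite ?wt_if; simp_if; reflexivity.
congr (if _ then _ else _); by apply/idP/idP; apply: covers_disjoint; rewrite // eq_sym.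
Qed.

Lemma dact_sqr n (i j : 'I_n) F : dact i j (dact i j F) = 0.
Proof.
apply/ffunP => u; rewrite !ffunE wtK.
case: eqP => // ->; case: eqP => //; lia.
Qed.

(** * Dunkl elements *)

Ltac abel := repeat match goal with
  | |- context[@dact ?n ?i ?j ?F] => move: (@dact n i j F) => ? end;
  apply/ffunP => ?; rewrite !ffunE; ring.

(* [dact i j] is symmetric in [i] and [j]; the Dunkl elements need the antisymmetric extension. *)
Definition sdact n (k m : 'I_n) (F : GAlg n) : GAlg n :=
  if (k < m)%N then dact k m F else - dact k m F.

Lemma sdact_is_additive n (k m : 'I_n) : zmod_morphism (@sdact n k m).
Proof. by move=> F G; rewrite /sdact; case: ifP; rewrite raddfB // opprD. Qed.
HB.instance Definition _ n (k m : 'I_n) :=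
  GRing.isZmodMorphism.Build (GAlg n) (GAlg n) (@sdact n k m) (@sdact_is_additive n k m).

Lemma sdactN n (k m : 'I_n) F : sdact k m F = - sdact m k F.
Proof.
rewrite /sdact (dactC m k); case: (ltngtP k m) => [||/val_inj->]; rewrite ?opprK //.
by rewrite dact_id oppr0.
Qed.

Lemma sdact_id n (k : 'I_n) F : sdact k k F = 0.
Proof. by rewrite /sdact ltnn dact_id oppr0. Qed.

Lemma sdact_disjoint n (i j k l : 'I_n) F :
  i != k -> i != l -> j != k -> j != l ->
  sdact i j (sdact k l F) = sdact k l (sdact i j F).
Proof.
by move=> *; rewrite /sdact; case: ifP; case: ifP; rewrite ?raddfN /= ?(@dact_disjoint n i j).
Qed.

(** With antisymmetric generators both three-term relations become one cyclic relation. Up to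
    rotation [i, j, k] is increasing ([T1], from [dact_three1]) or decreasing ([T2], from
    [dact_three2]). *)
Lemma sdact_three n (i j k : 'I_n) F : i != j -> j != k -> i != k ->
  sdact j k (sdact i j F) + sdact k i (sdact j k F) + sdact i j (sdact k i F) = 0.
Proof.
have T1 (a b c : 'I_n) : (a < b)%N -> (b < c)%N ->
  sdact b c (sdact a b F) + sdact c a (sdact b c F) + sdact a b (sdact c a F) = 0.
  move=> ab bc; have ac := ltn_trans ab bc.
  rewrite /sdact ab bc (ltnNge c a) (ltnW ac) /= !raddfN /= !(dactC c a).
  rewrite dact_three1 //; abel.
have T2 (a b c : 'I_n) : (a < b)%N -> (b < c)%N ->
  sdact b a (sdact c b F) + sdact a c (sdact b a F) + sdact c b (sdact a c F) = 0.
  move=> ab bc; have ac := ltn_trans ab bc.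
  rewrite /sdact ac (ltnNge c b) (ltnNge b a) (ltnW ab) (ltnW bc) /= !raddfN /= opprK.
  rewrite !(dactC c b) !(dactC b a) dact_three2 //; abel.
rewrite -!(inj_eq (@ord_inj n)) => nij njk nik.
case: (ltngtP i j) nij => // ij _; case: (ltngtP j k) njk => // jk _;
  case: (ltngtP i k) nik => // ik _; try lia.
- exact: T1.
- by rewrite -addrA addrC; exact: T2.
- by rewrite addrC addrA; exact: T1.
- by rewrite addrC addrA; exact: T2.
- by rewrite -addrA addrC; exact: T1.
- exact: T2.
Qed.

Definition theta n (k : 'I_n) (F : GAlg n) : GAlg n := \sum_m sdact k m F.

Lemma theta_is_additive n (k : 'I_n) : zmod_morphism (@theta n k).
Proof. by move=> F G; rewrite /theta -sumrB; apply: eq_bigr => m _; rewrite raddfB. Qed.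
HB.instance Definition _ n (k : 'I_n) :=
  GRing.isZmodMorphism.Build (GAlg n) (GAlg n) (@theta n k) (@theta_is_additive n k).

(** The commutator is the double sum of the commutators [g m m'] of single generators. Those with
    disjoint index pairs vanish; for each [r] other than [k] and [l] there remain [g l r], [g r k]
    and [g r r], whose sum is a difference of two cyclic relations. *)
Lemma theta_comm n (k l : 'I_n) F : theta k (theta l F) = theta l (theta k F).
Proof.
have [->//|nkl] := eqVneq k l.
have nlk : l != k by rewrite eq_sym.
pose g (m m' : 'I_n) := sdact k m (sdact l m' F) - sdact l m' (sdact k m F).
suff : \sum_m \sum_m' g m m' = 0.
  move=> E; apply/eqP; rewrite -subr_eq0 -E.
  have E1 (a b : 'I_n) : theta a (theta b F) = \sum_m \sum_m' sdact a m (sdact b m' F).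
    by rewrite {1}/theta; apply: eq_bigr => m _; rewrite raddf_sum.
  rewrite !E1 [X in _ - X]exchange_big -sumrB; apply/eqP/eq_bigr => m _.
  by rewrite -sumrB.
have gk m' : g k m' = 0 by rewrite /g !sdact_id raddf0 subrr.
have gl m : g m l = 0 by rewrite /g !sdact_id raddf0 subrr.
have glk : g l k = 0 by rewrite /g !(sdactN l k) !raddfN /= subrr.
have gd m m' : m != l -> m' != k -> m != m' -> g m m' = 0.
  by move=> ? ? ?; rewrite /g sdact_disjoint ?subrr // eq_sym.
rewrite (bigD1 k) //= big1 ?add0r // (bigD1 l) //= (bigD1 k) //= glk add0r (bigD1 l) //= gl add0r.
have E r : (r != k) && (r != l) -> \sum_m' g r m' = g r k + g r r.
  move=> /andP[rk rl]; rewrite (bigD1 k) //= (bigD1 r) //= big1 ?addr0 // => m' /andP[mk mr].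
  by apply: gd => //; rewrite eq_sym.
rewrite (eq_bigr _ E) -big_split big1 //= => r /andP[rk rl].
have kr : k != r by rewrite eq_sym.
have lr : l != r by rewrite eq_sym.
have := @sdact_three n k l r F nkl lr kr; have := @sdact_three n r l k F rl nlk rk.
rewrite /g !(sdactN r k) !(sdactN r l) !(sdactN l k) !raddfN /= !opprK.
move=> h1 h2; transitivity (0 - 0 : GAlg n); last by rewrite subrr.
by rewrite -{1}h1 -h2; abel.
Qed.

(** * Nil-Hecke relations for an adjacent transposition *)

(* The operator [U_i] above, for [p = i.+1]. *)
Definition raise n (i p : 'I_n) (F : GAlg n) : GAlg n :=
  [ffun v : 'S_n => if (v p < v i)%N then F (wt v i p) else 0].

Lemma raise_is_additive n (i p : 'I_n) : zmod_morphism (@raise n i p).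
Proof. by move=> F G; apply/ffunP => u; rewrite !ffunE; case: ifP; rewrite ?subr0. Qed.
HB.instance Definition _ n (i p : 'I_n) :=
  GRing.isZmodMorphism.Build (GAlg n) (GAlg n) (@raise n i p) (@raise_is_additive n i p).

Section Adjacent.
Variables (n : nat) (i p : 'I_n).
Hypothesis ip : p = i.+1 :> nat.

Let ltip : (i < p)%N. Proof. by rewrite ip. Qed.
Let nip : i != p. Proof. by rewrite neq_ltn ltip. Qed.

Lemma covers_adjacent u : covers u i p = (u i < u p)%N.
Proof.
apply/coversP/idP => [[]//|h]; split=> // q; apply/negP; lia.
Qed.

(** At each [u] exactly one term survives and returns [F u]: the first at a descent, the second at
    an ascent. This is the source of the constant in [raise_theta]. *)
Lemma raise_dact_adjacent F : raise i p (dact i p F) + dact i p (raise i p F) = F.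
Proof.
apply/ffunP => u; facts u nip.
rewrite 2!ffunE !dactE // !covers_adjacent ffunE !wtE tpermL tpermR wtK.
case: (ltngtP (u i) (u p)) => h; rewrite ?addr0 ?add0r //.
by move: h; lia.
Qed.

Lemma tperm_adjacent_lt (k m : 'I_n) : (k < m)%N -> (k != i) || (m != p) ->
  (tperm i p k < tperm i p m)%N.
Proof.
rewrite -!(inj_eq (@ord_inj n)).
by case: tpermP => [->|->|/eqP + /eqP]; case: tpermP => [->|->|/eqP + /eqP];
  rewrite -?(inj_eq (@ord_inj n)); lia.
Qed.

Ltac solve_raise u k m :=
  let h1 := fresh "h" in let h2 := fresh "h" in let H := fresh "H" in
  apply/idP/idP => [/andP[h1 /coversP[h2 H]]|/andP[/coversP[h2 H] h1]];
  move: h1 h2; rewrite ?wt_if; simp_if => h1 h2;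
  apply/andP; split; try (apply/coversP; split);
  try (let q := fresh "q" in move=> q;
       split_at u q i; last (split_at u q p; last (split_at u q k; last split_at u q m));
       move: (H q));
  move: (H i) (H p) (H k) (H m); clear H; rewrite ?wt_if; simp_if; purge; lia.

(** The coefficient form of [raise_dact]. The cases record which of [k] and [m] are moved by
    [tperm i p]. *)
Lemma covers_raise (u : 'S_n) (k m : 'I_n) : (k < m)%N -> (k != i) || (m != p) ->
  (u p < u i)%N && covers (wt u i p) k m =
  covers u (tperm i p k) (tperm i p m) &&
  (wt u (tperm i p k) (tperm i p m) p < wt u (tperm i p k) (tperm i p m) i)%N.
Proof.
move=> km; have nkm : k != m by rewrite neq_ltn km.
have nmk : m != k by rewrite eq_sym.
facts u nip; facts u nkm.
case: (eqVneq k i) => [ki|nki] /=.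
  move: km nkm nmk; rewrite {}ki tpermL => im nim nmi nmp.
  rewrite tpermD 1?eq_sym //; facts u nmp; facts u nmi.
  solve_raise u i m.
move=> _; facts u nki.
case: (eqVneq k p) => [kp|nkp].
  move: km nkm nmk; rewrite {}kp tpermR => pm npm nmp.
  have nmi : m != i by rewrite neq_ltn; apply/orP; right; apply: ltn_trans pm.
  rewrite tpermD 1?eq_sym //; facts u nmp; facts u nmi.
  solve_raise u p m.
rewrite (@tpermD _ i p k) 1?eq_sym //; facts u nkp.
case: (eqVneq m i) => [mi|nmi].
  move: km nkm nmk; rewrite {}mi tpermL => ki _ _.
  solve_raise u i k.
facts u nmi.
case: (eqVneq m p) => [mp|nmp].
  move: km nkm nmk; rewrite {}mp tpermR => kp _ _.
  solve_raise u p k.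
facts u nmp; rewrite tpermD 1?eq_sym //.
solve_raise u k m.
Qed.

Lemma raise_dact (k m : 'I_n) F : (k < m)%N -> (k != i) || (m != p) ->
  raise i p (dact k m F) = dact (tperm i p k) (tperm i p m) (raise i p F).
Proof.
move=> km kmip; apply/ffunP => u; rewrite dactE ?tperm_adjacent_lt // ffunE dactE //.
rewrite ffunE -!if_and covers_raise //; congr (if _ then F _ else 0).
rewrite /wt.
have -> : tperm (tperm i p k) (tperm i p m) = (tperm i p * tperm k m * tperm i p)%g.
  by rewrite -tpermJ conjgE tpermV mulgA.
by rewrite /wt !mulgA tperm2 mul1g.
Qed.

Lemma raise_sdact (k m : 'I_n) F : k != m ->
  (k != i) || (m != p) -> (m != i) || (k != p) ->
  raise i p (sdact k m F) = sdact (tperm i p k) (tperm i p m) (raise i p F).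
Proof.
move=> nkm h1 h2; rewrite /sdact; case: ltnP => [km|mk].
  by rewrite tperm_adjacent_lt // raise_dact.
have {}mk : (m < k)%N by move: nkm; rewrite -(inj_eq (@ord_inj n)); lia.
by rewrite ltnNge ltnW ?tperm_adjacent_lt //= raddfN /= dactC raise_dact // dactC.
Qed.

(** [raise] conjugates every summand of [theta k] by the adjacent transposition, except the
    generator of the pair [i, p] itself, where [raise_dact_adjacent] leaves a constant, with sign
    [+] for [k = i] and [-] for [k = p]. *)
Lemma raise_theta (k : 'I_n) F :
  raise i p (theta k F) =
  theta (tperm i p k) (raise i p F) + F *+ (k == i) - F *+ (k == p).
Proof.
have E : theta (tperm i p k) (raise i p F) =
         \sum_m sdact (tperm i p k) (tperm i p m) (raise i p F).
  by rewrite /theta (reindex_inj (@perm_inj _ (tperm i p))).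
(* The constants are placed at the one index [m] that produces them, so that the sums compare
   termwise. *)
have S (a b : 'I_n) : F *+ (k == a) = \sum_m F *+ ((k == a) && (m == b)).
  by rewrite (bigD1 b) //= eqxx andbT big1 ?addr0 // => m /negPf->; rewrite andbF.
rewrite E (S i p) (S p i) /theta raddf_sum /= -big_split -sumrB /=; apply: eq_bigr => m _.
have [<-|nkm] := eqVneq k m.
  rewrite !sdact_id raddf0 add0r.
  case: (eqVneq k i) => [->|_]; first by rewrite (negPf nip) subrr.
  by rewrite andbF subrr.
have npi : (p == i) = false by rewrite eq_sym (negPf nip).
have [/andP[/eqP Ek /eqP Em]|h1] := boolP ((k == i) && (m == p)).
  rewrite {}Ek {}Em {nkm} (negPf nip) tpermL tpermR subr0 (sdactN p i) /sdact ltip.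
  by rewrite -[X in _ + X]raise_dact_adjacent [RHS]addrC addrK.
have [/andP[/eqP Ek /eqP Em]|h2] := boolP ((k == p) && (m == i)).
  rewrite {}Ek {}Em {nkm} addr0 tpermL tpermR (sdactN p i) /sdact ltip raddfN /=.
  by rewrite -[X in _ - X]raise_dact_adjacent opprD addrCA subrr addr0.
by rewrite addr0 subr0 raise_sdact //; rewrite -negb_and // andbC.
Qed.
End Adjacent.

(** * Rows *)

Definition scale n (x : {mpoly rat[n]}) (F : GAlg n) : GAlg n := [ffun u => x * F u].

Lemma scale_is_additive n (x : {mpoly rat[n]}) : zmod_morphism (scale x).
Proof. by move=> F G; apply/ffunP => u; rewrite !ffunE mulrBr. Qed.
HB.instance Definition _ n (x : {mpoly rat[n]}) :=
  GRing.isZmodMorphism.Build (GAlg n) (GAlg n) (scale x) (@scale_is_additive n x).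

Lemma dact_scale n (i j : 'I_n) x F : dact i j (scale x F) = scale x (dact i j F).
Proof. by apply/ffunP => u; rewrite !ffunE; case: ifP; rewrite ?mulr0. Qed.

Lemma sdact_scale n (i j : 'I_n) x F : sdact i j (scale x F) = scale x (sdact i j F).
Proof. by rewrite /sdact dact_scale; case: ifP; rewrite ?raddfN. Qed.

Lemma theta_scale n (k : 'I_n) x F : theta k (scale x F) = scale x (theta k F).
Proof. by rewrite /theta raddf_sum; apply: eq_bigr => m _; rewrite sdact_scale. Qed.

Lemma scaleC n (x y : {mpoly rat[n]}) F : scale x (scale y F) = scale y (scale x F).
Proof. by apply/ffunP => u; rewrite !ffunE mulrCA. Qed.

Definition theta_factor n x (F : GAlg n) (k : 'I_n) : GAlg n := scale x F - theta k F.

Lemma theta_factorC n x y (k l : 'I_n) F :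
  theta_factor y (theta_factor x F k) l = theta_factor x (theta_factor y F l) k.
Proof.
rewrite /theta_factor !raddfB /= !theta_scale (theta_comm k l).
apply/ffunP => u; rewrite !ffunE; ring.
Qed.

(* [lower j k] is the paper's [B_{j,k+1}]. *)
Definition lower n (j : nat) (k : 'I_n) (F : GAlg n) : GAlg n :=
  \sum_(m : 'I_n | (m < j)%N) dact m k F.

Lemma lower_is_additive n j (k : 'I_n) : zmod_morphism (@lower n j k).
Proof. by move=> F G; rewrite /lower -sumrB; apply: eq_bigr => m _; rewrite raddfB. Qed.
HB.instance Definition _ n j (k : 'I_n) :=
  GRing.isZmodMorphism.Build (GAlg n) (GAlg n) (@lower n j k) (@lower_is_additive n j k).

Lemma lower_scale n j (k : 'I_n) x F : lower j k (scale x F) = scale x (lower j k F).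
Proof. by rewrite /lower raddf_sum; apply: eq_bigr => m _; rewrite dact_scale. Qed.

(** The positive part of [theta p], truncated at [t] so that a row can be built one factor at a
    time. *)
Definition upper n (p : 'I_n) t (F : GAlg n) : GAlg n :=
  \sum_(l : 'I_n | (p < l < t)%N) dact p l F.

Lemma upper_is_additive n (p : 'I_n) t : zmod_morphism (@upper n p t).
Proof. by move=> F G; rewrite /upper -sumrB; apply: eq_bigr => m _; rewrite raddfB. Qed.
HB.instance Definition _ n (p : 'I_n) t :=
  GRing.isZmodMorphism.Build (GAlg n) (GAlg n) (@upper n p t) (@upper_is_additive n p t).

Lemma upper_scale n (p : 'I_n) t x F : upper p t (scale x F) = scale x (upper p t F).
Proof. by rewrite /upper raddf_sum; apply: eq_bigr => m _; rewrite dact_scale. Qed.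

Lemma upper_recr n (p k : 'I_n) F : (p < k)%N ->
  upper p k.+1 F = upper p k F + dact p k F.
Proof.
move=> pk; rewrite /upper (bigD1 k) /=; last by rewrite pk ltnSn.
rewrite addrC; congr (_ + _); apply: eq_bigl => m; rewrite -(inj_eq (@ord_inj n)); lia.
Qed.

Definition lower_factor n j x (F : GAlg n) (k : 'I_n) : GAlg n := scale x F + lower j k F.

(** * Support conditions *)

Definition supp n (P : 'S_n -> Prop) (F : GAlg n) := forall u, F u != 0 -> P u.

Lemma suppS n (P Q : 'S_n -> Prop) F : (forall u, P u -> Q u) -> supp P F -> supp Q F.
Proof. by move=> PQ hF u /hF/PQ. Qed.

Lemma suppD n (P : 'S_n -> Prop) F G : supp P F -> supp P G -> supp P (F + G).
Proof.
move=> hF hG u; rewrite ffunE; have [->|/hF//] := eqVneq (F u) 0.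
by rewrite add0r => /hG.
Qed.

Lemma supp_scale n (P : 'S_n -> Prop) x F : supp P F -> supp P (scale x F).
Proof. by move=> hF u; rewrite ffunE mulf_eq0 negb_or => /andP[_ /hF]. Qed.

Lemma supp_dact n (P Q : 'S_n -> Prop) (m k : 'I_n) F : (m < k)%N -> supp P F ->
  (forall u, P (wt u m k) -> covers u m k -> Q u) -> supp Q (dact m k F).
Proof. by move=> mk hF PQ u; rewrite dactE //; case: ifP; rewrite ?eqxx // => c /hF/PQ; apply. Qed.

Lemma supp_lower_factor n (P Q : 'S_n -> Prop) j x (k : 'I_n) F : (j <= k)%N ->
  supp P F -> (forall u, P u -> Q u) ->
  (forall (m : 'I_n) u, (m < j)%N -> P (wt u m k) -> covers u m k -> Q u) ->
  supp Q (lower_factor j x F k).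
Proof.
move=> jk hF PQ h; apply: suppD; first by apply: supp_scale; apply: suppS hF.
rewrite /lower; elim/big_ind: _ => [u|F1 F2|m mj]; first by rewrite ffunE eqxx.
  exact: suppD.
by apply: supp_dact hF _; [lia | move=> u; apply: h].
Qed.

(** A surviving [u] would need [u m < u q] for the cover, whereas the permutation in the support of
    [H] that it comes from has the values [u m] at [q] and [u q] at [k], forcing [u q < u m]. *)
Lemma dact_kill n (m q k : 'I_n) H : (m < q)%N -> (q < k)%N ->
  supp (fun u => (u k < u q)%N) H -> dact m q (dact m k H) = 0.
Proof.
move=> mq qk hH; have mk := ltn_trans mq qk.
apply/ffunP => u; rewrite dact2E // ffunE; case: ifP => // /andP[/coversP[c _] _].
apply/eqP; apply/negPn/negP => /hH.
have n1 : m != q by rewrite neq_ltn mq.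
have n2 : q != k by rewrite neq_ltn qk.
have n3 : m != k by rewrite neq_ltn mk.
facts u n1; facts u n2; facts u n3.
rewrite !wt_if; simp_if; lia.
Qed.

Definition decr n (j : nat) (u : 'S_n) :=
  forall l l' : 'I_n, (j <= l)%N -> (l < l')%N -> (u l' < u l)%N.

(** Passing to the covered permutation [u] raises the value at [k]. The empty rectangle of the cover
    keeps it below the values at positions from [j] to [k - 1]. *)
Lemma decr_dact n j (m k : 'I_n) (u : 'S_n) : (m < j)%N -> (j <= k)%N ->
  decr j (wt u m k) -> covers u m k -> decr j u.
Proof.
move=> mj jk h /coversP[c1 c2] l l' jl ll'.
have nmk : m != k by rewrite neq_ltn (leq_trans mj jk).
have nml : m != l by rewrite neq_ltn (leq_trans mj jl).
have nml' : m != l' by rewrite neq_ltn (leq_trans mj) // ltnW // (leq_ltn_trans jl).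
have nll' : l != l' by rewrite neq_ltn ll'.
facts u nmk; facts u nml; facts u nml'; facts u nll'.
move: (h l l' jl ll') (c2 l).
case: (eqVneq l k) => [e|nlk].
  subst k; rewrite !wt_if; simp_if; purge; lia.
facts u nlk.
case: (eqVneq l' k) => [e|nl'k].
  subst k; rewrite !wt_if; simp_if; purge; lia.
facts u nl'k.
by rewrite !wt_if; simp_if.
Qed.

(** * Moving a truncated Dunkl factor through a row *)

Section Row.
Variables (n : nat) (p : 'I_n) (x : {mpoly rat[n]}).

Definition partial t (H : GAlg n) : GAlg n :=
  scale x H + lower p p H - upper p t H.

(** The invariant inside a row: earlier factors may have put values larger than [u p] at positions
    below [k], so [u p] dominates only those from [k] on. *)
Definition row_inv k (u : 'S_n) :=
  decr p.+1 u /\ forall l : 'I_n, (k <= l)%N -> (p < l)%N -> (u l < u p)%N.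

Lemma lower_recr j (k : 'I_n) F : j = p :> nat ->
  lower j.+1 k F = lower j k F + dact p k F.
Proof.
move=> ->; rewrite /lower (bigD1 p) //= addrC; congr (_ + _).
by apply: eq_bigl => m; rewrite -(inj_eq (@ord_inj n)); lia.
Qed.

(** The three-term relation for [m < p < k] turns the last two terms on the left into the diagonal
    of the double sum on the right. In the first term the diagonal dies by [dact_kill], and the rest
    commutes. *)
Lemma lower_exchange (k : 'I_n) H : (p < k)%N -> supp (row_inv k) H ->
  lower p p (lower p k H) + lower p p (dact p k H) - dact p k (lower p k H) =
  lower p k (lower p p H).
Proof.
move=> pk hH.
rewrite /lower [dact p k (\sum_(_ | _) _)]raddf_sum /= -addrA -sumrB -big_split.
under [RHS]eq_bigr do rewrite raddf_sum.
rewrite [RHS]exchange_big /=; apply: eq_bigr => m mp.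
rewrite dact_three2 // addrK raddf_sum /= (bigD1 m) //= dact_kill ?add0r //; last first.
  by apply: suppS hH => u [_]; apply.
rewrite [RHS](bigD1 m) //= addrC; congr (_ + _).
apply: eq_bigr => m' /andP[m'p m'm].
have ne a (b : 'I_n) : (a < b)%N -> a != b by rewrite neq_ltn => ->.
rewrite dact_disjoint //; first by rewrite eq_sym.
- exact/ne/(ltn_trans mp).
- by rewrite eq_sym ne.
- exact: ne.
Qed.

(* [partial n] is [x - theta_p]. In the right action, moving it leftwards through
   the factors [lower_factor p.+1 x ^~ k], [p < k], turns each of them into
   [lower_factor p x ^~ k] and [x - theta_p] itself into [lower_factor p x ^~ p]. *)
Lemma partial_lower_factor (k : 'I_n) H : (p < k)%N -> supp (row_inv k) H ->
  partial k.+1 (lower_factor p.+1 x H k) = lower_factor p x (partial k H) k.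
Proof.
move=> pk hH; rewrite /lower_factor lower_recr // /partial.
rewrite upper_recr //.
(* For [p < l < k] the support of [H] decreases from [l] to [k], so [dact_kill] applies. *)
have F1 : upper p k (dact p k H) = 0.
  apply: big1 => l /andP[pl lk]; apply: dact_kill => //.
  by apply: suppS hH => u [h _]; apply: h.
have F2 : upper p k (lower p k H) = lower p k (upper p k H).
  rewrite /upper raddf_sum; apply: eq_bigr => l /andP[pl lk].
  rewrite /lower raddf_sum /=; apply: eq_bigr => m mp.
  have ne a (b : 'I_n) : (a < b)%N -> a != b by rewrite neq_ltn => ->.
  have ml := ltn_trans mp pl.
  rewrite dact_disjoint //; first by rewrite eq_sym ne.
  - exact: ne.
  - by rewrite eq_sym ne.
  - exact: ne.
rewrite !raddfD /= !raddfN /= !lower_scale !upper_scale !dact_scale dact_sqr F1 F2.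
rewrite -(lower_exchange pk hH).
repeat match goal with
  | |- context[lower ?j ?i ?F] => move: (lower j i F) => ?
  | |- context[upper ?j ?i ?F] => move: (upper j i F) => ?
  | |- context[dact ?j ?i ?F] => move: (dact j i F) => ? end.
apply/ffunP => u; rewrite !ffunE; ring.
Qed.
End Row.

(** * Rows as products of Dunkl factors *)

Definition segment n (a b : nat) : seq 'I_n := [seq k : 'I_n <- enum 'I_n | (a <= k < b)%N].

Lemma val_segment n a b : (a <= b)%N -> (b <= n)%N ->
  map val (segment n a b) = iota a (b - a).
Proof.
move=> ab bn; rewrite /segment.
rewrite -(filter_map val (fun k => a <= k < b)%N) val_enum_ord.
have -> : iota 0 n = iota 0 a ++ iota a (b - a) ++ iota b (n - b).
  have -> : iota b (n - b) = iota (a + (b - a)) (n - b) by rewrite subnKC.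
  by rewrite -iotaD -[a in iota a]add0n -iotaD; congr iota; lia.
rewrite !filter_cat (eq_in_filter (a2 := pred0)) ?filter_pred0; last first.
  by move=> k; rewrite mem_iota /=; lia.
rewrite [X in _ ++ _ ++ X](eq_in_filter (a2 := pred0)) ?filter_pred0 ?cats0; last first.
  by move=> k; rewrite mem_iota /=; lia.
by apply/all_filterP/allP => k; rewrite mem_iota; lia.
Qed.

Lemma segment_rcons n a (k : 'I_n) : (a <= k)%N ->
  segment n a k.+1 = rcons (segment n a k) k.
Proof.
move=> ak; apply: (inj_map val_inj); rewrite map_rcons !val_segment //; try lia.
  by rewrite subSn // -addn1 iotaD cats1 subnKC.
exact: ltnW.
Qed.

Lemma segment_cons n (k : 'I_n) : segment n k n = k :: segment n k.+1 n.
Proof.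
apply: (inj_map val_inj) => /=; rewrite !val_segment //; last exact: ltnW.
by rewrite -(subnSK (ltn_ord k)).
Qed.

Lemma segment_nil n a : segment n a a = [::].
Proof. by rewrite /segment (eq_filter (a2 := pred0)) ?filter_pred0 // => k /=; lia. Qed.

Lemma decrS n j (u : 'S_n) : decr j u -> decr j.+1 u.
Proof. by move=> h l l' jl; apply: h; apply: ltnW. Qed.

Lemma supp_decr_lower_factor n j x (F : GAlg n) (k : 'I_n) : (j <= k)%N ->
  supp (decr j) F -> supp (decr j) (lower_factor j x F k).
Proof.
by move=> jk hF; apply: supp_lower_factor hF _ _ => // m u mj; apply: decr_dact.
Qed.

Lemma supp_decr_row n j x (F : GAlg n) (s : seq 'I_n) :
  all (fun k : 'I_n => j <= k)%N s ->
  supp (decr j) F -> supp (decr j) (foldl (lower_factor j x) F s).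
Proof.
elim: s F => //= k s IH F /andP[jk js] hF.
by apply: IH => //; apply: supp_decr_lower_factor.
Qed.

Lemma all_segment n j a b : (j <= a)%N -> all (fun k : 'I_n => j <= k)%N (segment n a b).
Proof. by move=> ja; apply/allP => k; rewrite mem_filter => /andP[/andP[/(leq_trans ja)]]. Qed.

(** Induction on [t], one exchange [partial_lower_factor] per factor. The support invariant is
    proved along with the identity because each exchange requires it. *)
Lemma partial_row n (p : 'I_n) x (G : GAlg n) t :
  supp (decr p) G -> (p < t)%N -> (t <= n)%N ->
  supp (row_inv p t) (foldl (lower_factor p.+1 x) G (segment n p.+1 t)) /\
  partial p x t (foldl (lower_factor p.+1 x) G (segment n p.+1 t)) =
  foldl (lower_factor p x) (lower_factor p x G p) (segment n p.+1 t).
Proof.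
move=> hG; elim: t => // t IH; rewrite ltnS leq_eqVlt => /orP[/eqP<- _|pt tn].
  rewrite segment_nil /=; split.
    apply: suppS hG => u hu; split; first exact: decrS.
    by move=> l _; apply: hu.
  rewrite /partial /upper big_pred0 ?subr0 // => l; lia.
have [hI E] := IH pt (ltnW tn).
rewrite -[t]/(val (Ordinal tn)) segment_rcons // !foldl_rcons; split; last first.
  by rewrite partial_lower_factor // E.
set k := Ordinal tn in hI *.
apply: supp_lower_factor hI _ _ => //.
  by move=> u [h1 h2]; split=> // l kl; apply: h2; apply: ltnW.
move=> m u mp [h1 h2] c; split; first exact: decr_dact h1 c.
move=> l kl pl.
have nmk : m != k by rewrite neq_ltn (leq_trans mp).
have nml : m != l by rewrite neq_ltn (leq_trans mp).
have nlk : k != l by rewrite neq_ltn kl.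
have npk : p != k by rewrite neq_ltn pt.
have npl : p != l by rewrite neq_ltn pl.
facts u nmk; facts u nml; facts u nlk; facts u npk; facts u npl.
have := h2 l (ltnW kl) pl; have := h1 k l pt kl.
case: (eqVneq p m) => [e|npm].
  by subst m; rewrite !wt_if; simp_if.
by facts u npm; rewrite !wt_if; simp_if.
Qed.

Lemma foldl_theta_factor n x y (G : GAlg n) (k : 'I_n) s :
  foldl (theta_factor x) (theta_factor y G k) s = theta_factor y (foldl (theta_factor x) G s) k.
Proof. by elim: s G => //= l s IH G; rewrite theta_factorC IH. Qed.

Lemma theta_upper_lower n (p : 'I_n) (F : GAlg n) : theta p F = upper p n F - lower p p F.
Proof.
rewrite /theta (bigID (fun m : 'I_n => (p < m)%N)) /=; congr (_ + _).
  by apply: eq_big => [m|m pm]; rewrite ?ltn_ord ?andbT // /sdact pm.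
rewrite (bigD1 p) ?ltnn //= sdact_id add0r /lower -sumrN.
apply: eq_big => [m|m /andP[mp _]]; last by rewrite /sdact (negPf mp) dactC.
by rewrite -(inj_eq (@ord_inj n)); lia.
Qed.

(** Downward induction on [j]. By [partial_row] at [t = n], the row from [p] on is the row from
    [p + 1] on followed by [x - theta_p], and commutation lets this factor be listed first. *)
Lemma row_theta n j x (G : GAlg n) : (j <= n)%N -> supp (decr j) G ->
  foldl (lower_factor j x) G (segment n j n) = foldl (theta_factor x) G (segment n j n).
Proof.
move=> jn; rewrite -(subKn jn); elim: (n - j)%N (leq_subr j n) G => [|d IH] dn G.
  by rewrite subn0 segment_nil.
have hp : (n - d.+1 < n)%N by lia.
rewrite -[(n - d.+1)%N]/(val (Ordinal hp)); set p := Ordinal hp => hG.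
have E : p.+1 = (n - d)%N by rewrite /=; lia.
rewrite segment_cons /= foldl_theta_factor E -IH; last first.
- by rewrite -E; apply: suppS hG => u; apply: decrS.
- exact: ltnW.
rewrite -E; have [_ <-] := partial_row x hG (ltn_ord p) (leqnn n).
rewrite /theta_factor theta_upper_lower /partial opprB addrA.
by rewrite addrC addrA addrC [X in _ + X]addrC addrA.
Qed.

(** * The commuting product formula for [SBPD] *)

Definition theta_pair n (F : GAlg n) (q : 'I_n * 'I_n) := theta_factor 'X_q.1 F q.2.

Lemma supp_basis_decr n : supp (decr 0) (Defs.basis (w0 n)).
Proof.
move=> u; rewrite ffunE; case: ifP => [/eqP-> _|_]; last by rewrite eqxx.
by move=> l l' _ ll'; rewrite !permE /=; have := ltn_ord l'; lia.
Qed.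

Lemma factor_actE n (i k : 'I_n) F : factor_act i k F = lower_factor i.+1 'X_i F k.
Proof. by apply/ffunP => u; rewrite !ffunE /lower sum_ffunE. Qed.

(** Induction on the number [d] of remaining rows. The row of [p] preserves decrease from [p + 1]
    on, which is the hypothesis for the rows after it. *)
Lemma foldl_factors n d (G : GAlg n) : (d <= n)%N -> supp (decr (n - d)) G ->
  let rows := [seq (i, k) | i : 'I_n <- segment n (n - d) n,
                            k : 'I_n <- [seq k : 'I_n <- enum 'I_n | (i < k)%N]] in
  foldl (fun F q => factor_act q.1 q.2 F) G rows = foldl (@theta_pair n) G rows.
Proof.
elim: d G => [|d IH] G dn hG; first by rewrite subn0 segment_nil.
have hp : (n - d.+1 < n)%N by lia.
move: hG; rewrite -[(n - d.+1)%N]/(val (Ordinal hp)); set p := Ordinal hp => hG rows.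
have E : p.+1 = (n - d)%N by rewrite /=; lia.
have hG1 : supp (decr p.+1) G by apply: suppS hG => u; apply: decrS.
have Es : [seq k : 'I_n <- enum 'I_n | (p < k)%N] = segment n p.+1 n.
  by apply: eq_filter => k; rewrite ltn_ord andbT.
have row (f : GAlg n -> 'I_n * 'I_n -> GAlg n) F :
    foldl f F [seq (p, k) | k <- segment n p.+1 n] =
    foldl (fun F k => f F (p, k)) F (segment n p.+1 n).
  by elim: (segment _ _ _) F => //=.
have -> : rows = [seq (p, k) | k <- segment n p.+1 n] ++
    [seq (i, k) | i : 'I_n <- segment n (n - d) n,
                  k : 'I_n <- [seq k : 'I_n <- enum 'I_n | (i < k)%N]].
  by rewrite /rows segment_cons /= Es E.
rewrite !foldl_cat !row.
have -> : foldl (fun F k => factor_act p k F) G (segment n p.+1 n) =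
          foldl (lower_factor p.+1 'X_p) G (segment n p.+1 n).
  by elim: (segment _ _ _) (G) => //= k s IHs F; rewrite factor_actE.
rewrite IH ?(ltnW dn) //; last first.
  by rewrite -E; apply: supp_decr_row => //; apply: all_segment.
by congr (foldl _ _ _); exact: row_theta.
Qed.

Lemma SBPD_theta n : SBPD n = foldl (@theta_pair n) (Defs.basis (w0 n)) (factors n).
Proof.
have := @foldl_factors n n (Defs.basis (w0 n)) (leqnn n).
rewrite subnn => /(_ (@supp_basis_decr n)) /=.
have <- // : enum 'I_n = segment n 0 n.
by rewrite /segment (eq_filter (a2 := predT)) ?filter_predT // => k /=; rewrite ltn_ord.
Qed.

(** * Divided differences *)

Lemma foldl_perm (T : eqType) (R : Type) (f : R -> T -> R) :
  (forall z x y, f (f z x) y = f (f z y) x) ->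
  forall s t z, perm_eq s t -> foldl f z s = foldl f z t.
Proof.
move=> fC; elim=> [|x s IH] t z st; first by case: t st => // y t /perm_size.
have xt : x \in t by rewrite -(perm_mem st) mem_head.
have hd : forall u z, x \in u -> foldl f z u = foldl f (f z x) (rem x u).
  elim=> //= y u IHu z'; rewrite inE eq_sym.
  by case: eqP => [->|_] //= xu; rewrite IHu // fC.
rewrite /= (hd t z xt); apply: IH.
by rewrite -(perm_cons x); apply: perm_trans st (perm_to_rem xt).
Qed.

Lemma theta_pairC n (F : GAlg n) q r :
  theta_pair (theta_pair F q) r = theta_pair (theta_pair F r) q.
Proof. exact: theta_factorC. Qed.

Lemma msymXU n (s : 'S_n) (i : 'I_n) : msym s 'X_i = 'X_(s i) :> {mpoly rat[n]}.
Proof. by rewrite /msym mmapX mmap1U. Qed.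

Definition symf n (s : 'S_n) (F : GAlg n) : GAlg n := [ffun u => msym s (F u)].

Lemma symf_is_additive n (s : 'S_n) : zmod_morphism (@symf n s).
Proof. by move=> F G; apply/ffunP => u; rewrite !ffunE msymB. Qed.
HB.instance Definition _ n (s : 'S_n) :=
  GRing.isZmodMorphism.Build (GAlg n) (GAlg n) (@symf n s) (@symf_is_additive n s).

Lemma symf_theta n (s : 'S_n) k (F : GAlg n) : symf s (theta k F) = theta k (symf s F).
Proof.
have D i j G : symf s (dact i j G) = dact i j (symf s G).
  by apply/ffunP => u; rewrite !ffunE; case: ifP; rewrite ?msym0.
rewrite /theta raddf_sum; apply: eq_bigr => m _.
by rewrite /= /sdact; case: ifP; rewrite ?raddfN /= D.
Qed.

Lemma symf_theta_pair n (s : 'S_n) q (F : GAlg n) :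
  symf s (theta_pair F q) = theta_pair (symf s F) (s q.1, q.2).
Proof.
rewrite /theta_pair /theta_factor raddfB /= symf_theta; congr (_ - _).
by apply/ffunP => u; rewrite !ffunE msymM msymXU.
Qed.

Lemma symf_basis n (s w : 'S_n) : symf s (Defs.basis w) = Defs.basis w.
Proof. by apply/ffunP => u; rewrite !ffunE; case: ifP; rewrite ?msym1 ?msym0. Qed.

Lemma symf_foldl n (s : 'S_n) (G : GAlg n) L :
  symf s (foldl (@theta_pair n) G L) =
  foldl (@theta_pair n) (symf s G) [seq (s q.1, q.2) | q <- L].
Proof. by elim: L G => //= q L IH G; rewrite IH symf_theta_pair. Qed.

Lemma mem_factors n (q : 'I_n * 'I_n) : (q \in factors n) = (q.1 < q.2)%N.
Proof.
apply/allpairsPdep/idP => [[i [k [_ +] ->]]|h]; first by rewrite mem_filter => /andP[].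
by exists q.1, q.2; rewrite mem_enum mem_filter h mem_enum; split=> //; case: q {h}.
Qed.

Lemma uniq_factors n : uniq (factors n).
Proof.
apply: allpairs_uniq_dep => [|i _|]; first exact: enum_uniq.
  exact/filter_uniq/enum_uniq.
by move=> [i k] [j l] _ _ /= [-> ->].
Qed.

(** * Exchanging two adjacent variables *)

Section Reflect.
Variables (n : nat) (i p : 'I_n).
Hypothesis ip : p = i.+1 :> nat.

Let s := tperm i p.
Let nip : i != p. Proof. by rewrite -(inj_eq (@ord_inj n)); lia. Qed.
Let npi : p != i. Proof. by rewrite eq_sym. Qed.
Let L := rem (i, p) (factors n).

Let memL q : (q \in L) = (q.1 < q.2)%N && (q != (i, p)).
Proof. by rewrite /L mem_rem_uniq ?uniq_factors // inE mem_factors andbC. Qed.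

Let uniqL : uniq L. Proof. exact/rem_uniq/uniq_factors. Qed.

(** Exchanging [x_i] and [x_p] permutes the factors [x_a - theta_k] with [a < k], apart from
    [(i, p)], whose image violates [a < k]. *)
Lemma perm_swap_factors : perm_eq [seq (s q.1, q.2) | q <- L] L.
Proof.
have sK : involutive (fun q : 'I_n * 'I_n => (s q.1, q.2)) by move=> [a b] /=; rewrite tpermK.
apply: uniq_perm => //; first by rewrite map_inj_uniq //; exact: inv_inj sK.
move=> q; rewrite -{1}(sK q) (mem_map (inv_inj sK)) !memL /=.
case: q => a b; rewrite !xpair_eqE /=.
rewrite -!(inj_eq (@ord_inj n)) /s.
by case: tpermP => [->|->|]; rewrite -?(inj_eq (@ord_inj n)) => *; lia.
Qed.

Lemma raise_theta_factor x k F :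
  raise i p (theta_factor x F k) = scale x (raise i p F) -
    (theta (s k) (raise i p F) + F *+ (k == i) - F *+ (k == p)).
Proof.
rewrite /theta_factor raddfB /= raise_theta //; congr (_ - _).
by apply/ffunP => u; rewrite !ffunE; case: ifP; rewrite ?mulr0.
Qed.

(** Each far factor, with [k] different from [i] and [p], commutes with [raise] and so preserves its
    kernel. The near factors come in pairs [(x_a - theta_i)(x_a - theta_p)] with [a < i]; each pair
    preserves the kernel because the two constants from [raise_theta] cancel. *)
Lemma raise_foldl : raise i p (foldl (@theta_pair n) (Defs.basis (w0 n)) L) = 0.
Proof.
pose far (q : 'I_n * 'I_n) := (q.2 != i) && (q.2 != p).
pose near := [seq (a, k) | a <- segment n 0 i, k <- [:: i; p]].
have pn : perm_eq [seq q <- L | predC far q] near.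
  apply: uniq_perm; first exact: filter_uniq.
    apply: allpairs_uniq; first exact/filter_uniq/enum_uniq.
      by rewrite /= inE nip.
    by move=> [? ?] [? ?] _ _ /= [-> ->].
  move=> [a k]; rewrite mem_filter memL /= /far /= xpair_eqE; apply/idP/allpairsP.
    move=> h; exists (a, k); rewrite mem_filter mem_enum !inE.
    by move: h; rewrite -!(inj_eq (@ord_inj n)) /=; split=> //; lia.
  move=> [[a' k'] [/= ]]; rewrite mem_filter mem_enum !inE => h1 h2 [-> ->].
  by move: h1 h2; rewrite -!(inj_eq (@ord_inj n)) /=; lia.
have pL : perm_eq L ([seq q <- L | far q] ++ near).
  by rewrite -(perm_filterC far L) perm_cat2l.
rewrite (foldl_perm (@theta_pairC n) _ pL) foldl_cat.
(* Swapping [i] and [p] in [w_0] creates an ascent, while [raise] only reaches descents. *)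
have base : raise i p (Defs.basis (w0 n)) = 0.
  apply/ffunP => v; rewrite !ffunE; case: ifP => // h; case: eqP => // e.
  move: (congr1 (fun w : 'S_n => w p) e) (congr1 (fun w : 'S_n => w i) e).
  rewrite /= !wtE tpermR tpermL !permE => /(congr1 val) /= e1 /(congr1 val) /= e2.
  by move: h; rewrite e1 e2; have := ltn_ord p; lia.
have hfar : forall M G, all far M -> raise i p G = 0 ->
    raise i p (foldl (@theta_pair n) G M) = 0.
  elim=> //= q M IH G /andP[/andP[/negPf qi /negPf qp] hM] hG; apply: IH => //.
  rewrite /theta_pair raise_theta_factor hG qi qp !mulr0n !raddf0 /=.
  by rewrite ?(addr0, subr0).
move: (hfar _ _ (filter_all far L) base); move: (foldl _ _ [seq q <- L | far q]).
rewrite /near; elim: (segment n 0 i) => //= a M IH G hG; apply: IH.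
rewrite /theta_pair /= raise_theta_factor (raise_theta_factor _ i) hG !raddf0 /s tpermR.
rewrite !eqxx (negPf nip) (negPf npi) !mulr0n !mulr1n !(raddf0, sub0r, add0r, addr0, subr0).
rewrite (raddfN (scale _)) (raddfN (theta i)) /= /theta_factor.
apply/ffunP => u; rewrite !ffunE; ring.
Qed.

(** With the factor [(i, p)] taken last, [SBPD n] is [x_i - theta_p] applied to a symmetric [W].
    Hence the exchange subtracts [(x_i - x_p) W], and [W] is [raise i p (SBPD n)] because [raise]
    kills [W]. *)
Lemma symf_SBPD : symf s (SBPD n) = SBPD n - scale ('X_i - 'X_p) (raise i p (SBPD n)).
Proof.
have pF : perm_eq (factors n) ((i, p) :: L).
  by apply: perm_to_rem; rewrite mem_factors /= ip.
rewrite SBPD_theta (foldl_perm (@theta_pairC n) _ pF) symf_foldl symf_basis /=.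
rewrite tpermL; pose W := foldl (@theta_pair n) (Defs.basis (w0 n)) L.
have move_out G q M : foldl (@theta_pair n) (theta_pair G q) M =
    theta_pair (foldl (@theta_pair n) G M) q.
  by elim: M G => //= r M IH G; rewrite theta_pairC IH.
rewrite !move_out (foldl_perm (@theta_pairC n) _ perm_swap_factors) -/W.
have W0 : raise i p W = 0 := raise_foldl.
rewrite {3}/theta_pair raise_theta_factor W0 !raddf0 eqxx (negPf npi) mulr1n mulr0n.
rewrite !add0r opprK /theta_pair /theta_factor /=.
apply/ffunP => u; rewrite !ffunE; ring.
Qed.

Lemma SBPD_ddiff (w : 'S_n) : (w i < w p)%N ->
  SBPD n w = ddiff i p (SBPD n (wt w i p)).
Proof.
move=> h.
have E : ('X_i - 'X_p) * SBPD n w = SBPD n (wt w i p) - msym s (SBPD n (wt w i p)).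
  move/ffunP: symf_SBPD => /(_ (wt w i p)).
  rewrite !ffunE !wtE tpermL tpermR h wtK => ->.
  ring.
have nz : 'X_i - 'X_p != 0 :> {mpoly rat[n]}.
  rewrite subr_eq0; apply/eqP => /(congr1 (mcoeff U_(i)%MM)).
  by rewrite !mcoeffXU eqxx (negPf npi) => /eqP; rewrite oner_eq0.
(* [ddiff] is a chosen quotient; cancelling the nonzero [x_i - x_p] identifies it. *)
apply: (mulfI nz); rewrite E /ddiff.
by rewrite (epsilon_spec (inhabits 0)
  (fun g : {mpoly rat[n]} => ('X_i - 'X_p) * g = _) (ex_intro _ _ E)).
Qed.
End Reflect.

(** * The coefficient at [w_0] and the recursion from it *)

Lemma foldl_factor_act_w0 n (G : GAlg n) (M : seq ('I_n * 'I_n)) :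
  all (fun q : 'I_n * 'I_n => q.1 < q.2)%N M ->
  foldl (fun F q => factor_act q.1 q.2 F) G M (w0 n) =
  (\prod_(q <- M) 'X_q.1) * G (w0 n).
Proof.
elim: M G => [|[i k] M IH] G /=; first by rewrite big_nil mul1r.
move=> /andP[ik hM]; rewrite IH // big_cons /= ffunE [X in _ + X]big1 ?addr0 ?mulrA; last first.
  (* [w_0] has no ascent, so no [d_{m,k}] contributes to its coefficient. *)
  move=> m mi; have mk : (m < k)%N := leq_ltn_trans mi ik.
  rewrite dactE //; case: ifP => // /andP[]; rewrite !permE /=.
  by have := ltn_ord k; lia.
by rewrite [in RHS](mulrC 'X_i).
Qed.

Lemma SBPD_w0 n : SBPD n (w0 n) = schub_top n.
Proof.
rewrite /SBPD foldl_factor_act_w0; last by apply/allP => q; rewrite mem_factors.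
rewrite ffunE eqxx mulr1 /factors /schub_top big_allpairs_dep /= big_enum /=.
apply: eq_bigr => i _; rewrite big_const_seq count_predT.
rewrite -[filter _ _](_ : segment n i.+1 n = _); last first.
  by apply: eq_filter => k; rewrite ltn_ord andbT.
rewrite -(size_map val) val_segment // size_iota.
have -> : (n - i.+1 = n.-1 - i)%N by lia.
by elim: (_ - _)%N => //= m ->; rewrite exprS.
Qed.

(** Counting descents from the left end bounds [w i] above by [n - 1 - i], and from the right end
    bounds it below by the same number. *)
Lemma no_ascent_w0 n (w : 'S_n) :
  (forall i p : 'I_n, p = i.+1 :> nat -> (w p < w i)%N) -> w = w0 n.
Proof.
move=> h; apply/permP => i; apply/val_inj; rewrite permE /=.
have up : forall i, (w i + i <= n.-1)%N.
  move=> [k]; elim: k => [|k IH] hk.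
    by have := ltn_ord (w (Ordinal hk)); rewrite /=; lia.
  by have := h (Ordinal (ltnW hk)) (Ordinal hk) erefl; have := IH (ltnW hk); rewrite /=; lia.
have down : forall d (i : 'I_n), (i + d = n.-1)%N -> (d <= w i)%N.
  elim=> // d IH j jd; have hj : (j.+1 < n)%N by lia.
  have := h j (Ordinal hj) erefl; have := IH (Ordinal hj); rewrite /=; lia.
have := up i; have := down (n.-1 - i)%N i; have := ltn_ord i; lia.
Qed.

(** Strict because a diagonal pair is never an inversion; this makes [n * n] enough fuel. *)
Lemma ell_lt n (w : 'S_n) : (0 < n)%N -> (ell w < n * n)%N.
Proof.
move=> n0; have -> : (n * n = #|[set: 'I_n * 'I_n]|)%N by rewrite cardsT card_prod card_ord.
rewrite /ell.
apply: proper_card; rewrite properE subsetT /=; apply/subsetPn.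
by exists (Ordinal n0, Ordinal n0); rewrite !inE //= ltnn.
Qed.

(** Each call spends one unit of fuel and gains one unit of length, so the bound persists and fuel
    never runs out before [w_0]. The ascent picked is irrelevant since [SBPD_ddiff] holds at every
    ascent. *)
Lemma schub_fuel_SBPD n fuel (w : 'S_n) : (0 < n)%N -> (n * n <= ell w + fuel)%N ->
  schub_fuel fuel w = SBPD n w.
Proof.
move=> n0; elim: fuel w => [|f IH] w hw; first by have := ell_lt w n0; lia.
rewrite /=; case: eqP => [->|nw]; first by rewrite SBPD_w0.
case: pickP => [[i p] /= /andP[/eqP ip wip]|none].
  rewrite IH -?SBPD_ddiff //.
  have := @ell_covers n w i p; rewrite (covers_adjacent ip) wip ip ltnSn.
  by move=> /(_ isT)/eqP ->; lia.
case: nw; apply: no_ascent_w0 => i p ip.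
have ne : p != i by rewrite -(inj_eq (@ord_inj n)); lia.
have := none (i, p); have := perm_val_neq w ne; rewrite /= ip eqxx /=; lia.
Qed.

Theorem theorem4p2 (n : nat) (hn : (1 <= n)%N) :
  SBPD n = \sum_(w : 'S_n) [ffun u => if u == w then schubert w else 0].
Proof.
apply/ffunP => u; rewrite sum_ffunE (bigD1 u) //= ffunE eqxx big1 ?addr0.
  by rewrite /schubert schub_fuel_SBPD // leq_addl.
by move=> w /negPf wu; rewrite ffunE eq_sym wu.
Qed.
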